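(* Let $P\subset M_{\mathbb{R}}$ be a full-dimensional lattice polytope with $F(P)\neq\emptyset$, let $\widetilde{\Sigma}$ be the normal fan of $\widetilde{P}:=F(P)+C(P)$ and $\widetilde{V}$ its projective toric variety. Let $\widehat{\Sigma}$ be a projective refinement of $\widetilde{\Sigma}$ such that $\widehat{\Sigma}[1]=S_F(P)$. Then the corresponding projective toric morphism $\varphi:\widehat{V}\to\widetilde{V}$ is crepant. Furthermore, if $\psi:V\to\widetilde{V}$ is a toric desingularization of $\widetilde{V}$ defined by a regular refinement $\Sigma$ of $\widetilde{\Sigma}$, then $$K_V=\psi^*K_{\widetilde{V}}+\sum_{\nu\in\Sigma[1]\setminus\widetilde{\Sigma}[1]}\widetilde{a}(\nu)D_\nu,$$ where $\widetilde{a}(\nu):=\mathrm{Min}_{F(P)}(\nu)-\mathrm{Min}_{C(P)}(\nu)-1$. In particular, $\varphi:\widehat{V}\to\widetilde{V}$ is a maximal projective partial crepant desingularization of $\widetilde{V}$.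
   Context: $M\cong\mathbb{Z}^d$ is a lattice, $N=\mathrm{Hom}(M,\mathbb{Z})$ its dual, $\langle\cdot,\cdot\rangle$ the natural pairing, extended to $M_{\mathbb{R}}$ and $N_{\mathbb{R}}$. For a compact convex set $\square\subset M_{\mathbb{R}}$ put $\mathrm{Min}_\square(y)=\min_{x\in\square}\langle x,y\rangle$, $y\in N_{\mathbb{R}}$. The Fine interior is $F(P)=\{x\in M_{\mathbb{R}}\mid \langle x,\nu\rangle\ge \mathrm{Min}_P(\nu)+1\ \forall \nu\in N\setminus\{0\}\}$. If $F(P)\ne\emptyset$, the support of the Fine interior is $S_F(P)=\{\nu\in N\setminus\{0\}\mid \mathrm{Min}_{F(P)}(\nu)=\mathrm{Min}_P(\nu)+1\}$ and the canonical hull is $C(P)=\{x\in M_{\mathbb{R}}\mid \langle x,\nu\rangle\ge\mathrm{Min}_P(\nu)\ \forall\nu\in S_F(P)\}$. Normal fans are taken with inward normals. For a fan $\Sigma$, $\Sigma[1]\subset N$ is the set of primitive lattice generators of its $1$-dimensional cones, and $D_\nu$ is the torus-invariant prime divisor of $\nu\in\Sigma[1]$. $\widehat{V}$ and $V$ are the toric varieties of $\widehat{\Sigma}$ and $\Sigma$. A fan is regular if its toric variety is smooth. $\varphi$ is crepant if $\varphi^*K_{\widetilde{V}}=K_{\widehat{V}}$. ''Maximal'' means that $\widehat{\Sigma}[1]$ contains every primitive $\nu\in N$ whose toric divisor has discrepancy $0$ over $\widetilde{V}$ and is not already a divisor on $\widetilde V$ (i.e. all crepant toric divisors are extracted). 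*)

(* Defs.v *)
From HB Require Import structures.
From mathcomp Require Import all_boot all_order all_algebra.
From mathcomp Require Import all_classical all_reals all_analysis.
Import Order.TTheory GRing.Theory Num.Theory.
Import numFieldNormedType.Exports.

Set Implicit Arguments.
Unset Strict Implicit.
Unset Printing Implicit Defensive.

Local Open Scope classical_set_scope.
Local Open Scope ring_scope.

(* The lattice M is Z^d, written as integer row vectors; its dual N = Hom(M, Z)
   consists of integer column vectors, and the pairing is the matrix product.
   M_R and N_R are the corresponding spaces of real vectors. *)

Definition re {R : realType} {m n : nat} (A : 'M[int]_(m, n)) : 'M[R]_(m, n) :=
  map_mx intr A.

Definition pairing {A : pzRingType} {d : nat} (x : 'rV[A]_d) (y : 'cV[A]_d) : A :=
  (x *m y) 0 0.

Section Polytopes.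
Context {R : realType} {d : nat}.
Implicit Types (P Q F : set 'rV[R]_d) (y : 'cV[R]_d).

Definition lattice_polytope P : Prop :=
  exists s : seq 'rV[int]_d,
    P = [set x | exists a : 'rV[int]_d -> R,
           [/\ forall v, 0 <= a v,
               \sum_(v <- s) a v = 1
             & x = \sum_(v <- s) a v *: re v]].

Definition full_dimensional P : Prop := interior P !=set0.

(* On a nonempty compact set the infimum is attained, so this is the minimum. *)
Definition Min Q y : R := inf [set pairing x y | x in Q].

Definition fine_interior P : set 'rV[R]_d :=
  [set x | forall nu : 'cV[int]_d, nu != 0 ->
     Min P (re nu) + 1 <= pairing x (re nu)].

Definition support_fine_interior P : set 'cV[int]_d :=
  [set nu | nu != 0 /\ Min (fine_interior P) (re nu) = Min P (re nu) + 1].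

Definition canonical_hull P : set 'rV[R]_d :=
  [set x | forall nu, support_fine_interior P nu ->
     Min P (re nu) <= pairing x (re nu)].

Definition minkowski_sum P Q : set 'rV[R]_d := [set x + z | x in P & z in Q].

Definition tilde_polytope P : set 'rV[R]_d :=
  minkowski_sum (fine_interior P) (canonical_hull P).

Definition polytope_face Q y : set 'rV[R]_d :=
  [set x | Q x /\ pairing x y = Min Q y].

Definition normal_cone Q F : set 'cV[R]_d :=
  [set y | forall x, F x -> pairing x y = Min Q y].

Definition normal_fan Q : set (set 'cV[R]_d) :=
  [set normal_cone Q (polytope_face Q y) | y in [set: 'cV[R]_d]].

End Polytopes.

Section Fans.
Context {R : realType} {d : nat}.
Implicit Types (sigma tau : set 'cV[R]_d) (Sigma : set (set 'cV[R]_d)).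

Definition cone_gen (s : seq 'cV[int]_d) : set 'cV[R]_d :=
  [set y | exists2 a : 'cV[int]_d -> R,
     forall v, 0 <= a v & y = \sum_(v <- s) a v *: re v].

Definition rational_cone sigma : Prop :=
  exists s : seq 'cV[int]_d, sigma = cone_gen s.

Definition strongly_convex sigma : Prop :=
  forall y, sigma y -> sigma (- y) -> y = 0.

Definition cone_face tau sigma : Prop :=
  exists2 x : 'rV[R]_d, forall y, sigma y -> 0 <= pairing x y
    & tau = [set y | sigma y /\ pairing x y = 0].

Definition is_fan Sigma : Prop :=
  [/\ finite_set Sigma,
      forall sigma, Sigma sigma -> rational_cone sigma /\ strongly_convex sigma,
      forall sigma tau, Sigma sigma -> cone_face tau sigma -> Sigma tau
    & forall sigma tau, Sigma sigma -> Sigma tau ->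
        cone_face (sigma `&` tau) sigma /\ cone_face (sigma `&` tau) tau].

Definition refinement Sigma' Sigma : Prop :=
  [/\ is_fan Sigma',
      forall sigma', Sigma' sigma' ->
        exists2 sigma, Sigma sigma & sigma' `<=` sigma
    & \bigcup_(sigma in Sigma') sigma = \bigcup_(sigma in Sigma) sigma].

(* Combinatorial form of projectivity of the toric morphism of a refinement:
   there is a Cartier divisor on the source whose support function h, integral
   and linear on the cones of Sigma', is strictly concave over every cone of
   Sigma (concave rather than convex as in y |-> Min Q y). *)
Definition relatively_projective Sigma' Sigma : Prop :=
  exists h : 'cV[R]_d -> R,
    (forall sigma', Sigma' sigma' -> exists m : 'rV[int]_d,
       forall y, sigma' y -> h y = pairing (re m) y) /\
    (forall sigma y z, Sigma sigma -> sigma y -> sigma z ->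
       h y + h z <= h (y + z) /\
       (h y + h z = h (y + z) <->
        exists sigma', [/\ Sigma' sigma', sigma' y & sigma' z])).

Definition projective_refinement Sigma' Sigma : Prop :=
  refinement Sigma' Sigma /\ relatively_projective Sigma' Sigma.

Definition primitive (nu : 'cV[int]_d) : Prop :=
  forall (k : nat) (mu : 'cV[int]_d), nu = mu *+ k -> k = 1%N.

(* Sigma[1] *)
Definition rays Sigma : set 'cV[int]_d :=
  [set nu | primitive nu /\ Sigma (cone_gen [:: nu])].

(* Every cone is generated by part of a Z-basis of N (the columns of B). *)
Definition regular_fan Sigma : Prop :=
  forall sigma, Sigma sigma ->
    exists (B : 'M[int]_d) (J : {set 'I_d}),
      B \in unitmx /\ sigma = cone_gen [seq col j B | j <- enum J].

Definition toric_desingularization Sigma' Sigma : Prop :=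
  refinement Sigma' Sigma /\ regular_fan Sigma'.

End Fans.

(* Torus-invariant divisors on the toric variety of a fan, and toric morphisms
   given by refinements.  A divisor is the function sending nu to the
   coefficient of D_nu; it vanishes outside the rays of the fan. *)
Section Divisors.
Context {R : realType} {d : nat}.
Implicit Types (Sigma : set (set 'cV[R]_d)).

Definition divisor : Type := 'cV[int]_d -> R.
Implicit Types (D E : divisor).

(* \sum_(nu in A) a(nu) D_nu *)
Definition divisor_sum (A : set 'cV[int]_d) (a : 'cV[int]_d -> R) : divisor :=
  fun nu => if nu \in A then a nu else 0.

Definition divisor_on Sigma D : Prop :=
  forall nu, ~ rays Sigma nu -> D nu = 0.

(* The divisor of the invariant form dlog(x_1) /\ ... /\ dlog(x_d). *)
Definition canonical_divisor Sigma : divisor := divisor_sum (rays Sigma) (fun=> -1).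

(* On each affine chart U_sigma, k D is the divisor of the character chi^(m sigma),
   whose order along D_nu is <m sigma, nu>.  A torus-invariant divisor that is
   principal on U_sigma always has a local equation of this form. *)
Definition local_equations Sigma D (k : nat) (m : set 'cV[R]_d -> 'rV[int]_d) : Prop :=
  forall sigma nu, Sigma sigma -> rays Sigma nu -> sigma (re nu) ->
    k%:R * D nu = (pairing (m sigma) nu)%:~R.

(* D is Q-Cartier on the toric variety of Sigma and E is its pullback under the
   toric morphism of the refinement Sigma': over U_sigma, k E is the divisor of
   the same local equation chi^(m sigma).  E is unique, since the cones of a fan
   are generated by their rays. *)
Definition is_pullback Sigma' Sigma D E : Prop :=
  [/\ divisor_on Sigma D, divisor_on Sigma' E
    & exists (k : nat) (m : set 'cV[R]_d -> 'rV[int]_d),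
        [/\ (0 < k)%N, local_equations Sigma D k m
          & forall sigma nu, Sigma sigma -> rays Sigma' nu -> sigma (re nu) ->
              k%:R * E nu = (pairing (m sigma) nu)%:~R]].

Definition crepant Sigma' Sigma : Prop :=
  is_pullback Sigma' Sigma (canonical_divisor Sigma) (canonical_divisor Sigma').

(* a is the coefficient of D_nu in K_V' - psi^* K_V for some toric modification
   psi : V' -> V on which D_nu is a divisor. *)
Definition has_discrepancy Sigma (nu : 'cV[int]_d) (a : R) : Prop :=
  exists Sigma' E,
    [/\ refinement Sigma' Sigma, rays Sigma' nu,
        is_pullback Sigma' Sigma (canonical_divisor Sigma) E
      & canonical_divisor Sigma' nu = E nu + a].

Definition extracts_all_crepant Sigma' Sigma : Prop :=
  forall nu, primitive nu -> ~ rays Sigma nu -> has_discrepancy Sigma nu 0 ->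
    rays Sigma' nu.

Definition maximal_projective_crepant_desingularization Sigma' Sigma : Prop :=
  [/\ projective_refinement Sigma' Sigma, crepant Sigma' Sigma
    & extracts_all_crepant Sigma' Sigma].

End Divisors.

(* Main.v *)
(* Write F and C for the fine interior and the canonical hull of P, and S for the
   support.  On every cone of the normal fan of F + C, both Min F and Min C are
   linear, so Min C - Min F is given there by a vector; on S it equals -1, and the
   rays of the normal fan lie in S since Sigma_hat refines it with rays S.  Hence
   Min C - Min F is the support function of the pullback of the canonical divisor
   to any refinement, which gives the discrepancies.  If nu has discrepancy 0 then
   Min F nu = Min C nu + 1 <= Min P nu + 1 <= Min F nu, so nu is in S.

   The analytic input is that C is compact, that is, S spans N_R positively: by
   Dirichlet approximation the slack <x, y> - Min P y is at least r |y| on F, so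
   near F only finitely many lattice vectors matter, and one of them in S stops
   every direction of escape from F.  The cones of the normal fan are generated by
   its rays because Min (F + C) is the minimum of finitely many linear functions. *)
Require Import Defs.
From HB Require Import structures.
From mathcomp Require Import all_boot all_order all_algebra.
From mathcomp Require Import all_classical all_reals all_analysis.
From mathcomp Require Import ring lra zify.
Import Order.TTheory GRing.Theory Num.Theory.
Import numFieldNormedType.Exports.

Local Open Scope classical_set_scope.
Local Open Scope ring_scope.

Set Implicit Arguments.
Unset Strict Implicit.
Unset Printing Implicit Defensive.

(** * The pairing and minima of linear functionals *)

Section Pairing.
Context {A : comNzRingType} {d : nat}.
Implicit Types (x : 'rV[A]_d) (y : 'cV[A]_d) (a : A).

Lemma pairingE x y : pairing x y = \sum_i x 0 i * y i 0.
Proof. by rewrite /pairing mxE. Qed.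

Lemma pairingDl x x' y : pairing (x + x') y = pairing x y + pairing x' y.
Proof. by rewrite /pairing mulmxDl mxE. Qed.

Lemma pairingDr x y y' : pairing x (y + y') = pairing x y + pairing x y'.
Proof. by rewrite /pairing mulmxDr mxE. Qed.

Lemma pairingNl x y : pairing (- x) y = - pairing x y.
Proof. by rewrite /pairing mulNmx mxE. Qed.

Lemma pairingNr x y : pairing x (- y) = - pairing x y.
Proof. by rewrite /pairing mulmxN mxE. Qed.

Lemma pairingBl x x' y : pairing (x - x') y = pairing x y - pairing x' y.
Proof. by rewrite pairingDl pairingNl. Qed.

Lemma pairingBr x y y' : pairing x (y - y') = pairing x y - pairing x y'.
Proof. by rewrite pairingDr pairingNr. Qed.

Lemma pairingZl a x y : pairing (a *: x) y = a * pairing x y.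
Proof. by rewrite /pairing -scalemxAl mxE. Qed.

Lemma pairingZr a x y : pairing x (a *: y) = a * pairing x y.
Proof. by rewrite /pairing -scalemxAr mxE. Qed.

Lemma pairing0r x : pairing x 0 = 0.
Proof. by rewrite /pairing mulmx0 mxE. Qed.

Lemma pairing_delta x i : pairing x (delta_mx i 0) = x 0 i.
Proof.
rewrite pairingE (bigD1 i) //= mxE !eqxx mulr1 big1 ?addr0 // => j ji.
by rewrite mxE (negPf ji) mulr0.
Qed.

End Pairing.

Section LatticeVectors.
Context {R : realType}.

Lemma pairing_re {d} (m : 'rV[int]_d) (nu : 'cV[int]_d) :
  pairing (re m) (re nu) = (pairing m nu)%:~R :> R.
Proof. by rewrite /pairing /re -map_mxM mxE. Qed.

Lemma re_inj {m n} : injective (@re R m n).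
Proof.
move=> A B /matrixP AB; apply/matrixP => i j.
by have := AB i j; rewrite !mxE => /intr_inj.
Qed.

Lemma re0 {m n} : re 0 = 0 :> 'M[R]_(m, n).
Proof. exact: map_mx0. Qed.

Lemma re_delta {m n} (i : 'I_m) (j : 'I_n) :
  re (delta_mx i j) = delta_mx i j :> 'M[R]_(m, n).
Proof. exact: map_delta_mx. Qed.

Lemma reN {m n} (x : 'M[int]_(m, n)) : re (- x) = - re x :> 'M[R]_(m, n).
Proof. exact: map_mxN. Qed.

End LatticeVectors.

Section MatrixNorm.
Context {R : realType} {m n : nat}.
Implicit Types A : 'M[R]_(m, n).

Lemma coord_le_norm A i j : `|A i j| <= `|A|.
Proof.
rewrite [leRHS]/Num.norm /= mx_normrE.
by apply/bigmax_geP; right => /=; exists (i, j).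
Qed.

Lemma norm_le_coord A (c : R) :
  0 <= c -> (forall i j, `|A i j| <= c) -> `|A| <= c.
Proof.
move=> c0 Ac; rewrite [leLHS]/Num.norm /= mx_normrE.
by apply/bigmax_leP; split => // -[i j] _ /=.
Qed.

End MatrixNorm.

Section MinLemmas.
Context {R : realType} {d : nat}.
Implicit Types (P Q : set 'rV[R]_d) (x : 'rV[R]_d) (y : 'cV[R]_d).

Lemma norm_pairing x y : `|pairing x y| <= d%:R * `|x| * `|y|.
Proof.
rewrite pairingE; apply: (le_trans (ler_norm_sum _ _ _)).
apply: (@le_trans _ _ (\sum_(i < d) `|x| * `|y|)).
  by apply: ler_sum => i _; rewrite normrM ler_pM // coord_le_norm.
by rewrite sumr_const card_ord -[leLHS]mulr_natl mulrA.
Qed.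

Lemma bounded_normP Q : bounded_set Q ->
  exists2 K : R, 0 < K & forall x, Q x -> `|x| <= K.
Proof.
move=> [M [_ QM]]; exists (`|M| + 1) => [|x]; first by rewrite ltr_wpDl.
by apply: QM; rewrite ltr_pwDr // ler_norm.
Qed.

Lemma norm_bounded Q (K : R) : (forall x, Q x -> `|x| <= K) -> bounded_set Q.
Proof.
move=> QK; exists K; split; first exact: num_real.
by move=> M KM x /QK /le_trans; apply; exact: ltW.
Qed.

Lemma le_Min Q y (c : R) :
  Q !=set0 -> (forall x, Q x -> c <= pairing x y) -> c <= Min Q y.
Proof.
move=> [x Qx] Qc; apply: lb_le_inf; first by exists (pairing x y), x.
by move=> _ [z Qz <-]; exact: Qc.
Qed.

Lemma Min_le Q x y : bounded_set Q -> Q x -> Min Q y <= pairing x y.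
Proof.
move=> /bounded_normP[K K0 QK] Qx; apply: ge_inf; last by exists x.
exists (- (d%:R * K * `|y|)) => _ [z /QK Qz <-].
rewrite lerNl (le_trans (ler_norm _)) // normrN.
by rewrite (le_trans (norm_pairing _ _)) // ler_wpM2r // ler_wpM2l.
Qed.

(** Attained minima stand in for compactness from here on: they make the infimum in [Min] a true
    minimum and are inherited by Minkowski sums. *)
Definition minimized Q : Prop := forall y,
  exists2 x, Q x & forall z, Q z -> pairing x y <= pairing z y.

Lemma Min_eq Q x y : Q x -> (forall z, Q z -> pairing x y <= pairing z y) ->
  Min Q y = pairing x y.
Proof.
move=> Qx xmin; apply/eqP; rewrite eq_le le_Min ?andbT //; last by exists x.
by apply: ge_inf; [exists (pairing x y) => _ [z Qz <-]; exact: xmin | exists x].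
Qed.

Lemma minimized_le Q x y : minimized Q -> Q x -> Min Q y <= pairing x y.
Proof.
by move=> Qmin Qx; have [z Qz zmin] := Qmin y; rewrite (Min_eq Qz) ?zmin.
Qed.

Lemma minimized_face Q y : minimized Q -> polytope_face Q y !=set0.
Proof.
move=> Qmin; have [z Qz zmin] := Qmin y.
by exists z; split; rewrite // (Min_eq Qz).
Qed.

Lemma continuous_pairing y : continuous (fun x : 'rV[R]_d => pairing x y).
Proof.
have -> : (fun x : 'rV[R]_d => pairing x y) = fun x => \sum_i x 0 i * y i 0.
  by apply/funext => x; rewrite pairingE.
apply: continuous_big => [|i _ x]; first exact: add_continuous.
apply: (@continuousM R 'rV[R]_d (fun x => x 0 i) (fun=> y i 0)).
  exact: coord_continuous.
exact: cst_continuous.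
Qed.

Lemma closed_halfspaces (I : Type) (A : set I) (f : I -> 'cV[R]_d) (c : I -> R) :
  closed [set x : 'rV[R]_d | forall i, A i -> c i <= pairing x (f i)].
Proof.
have -> : [set x : 'rV[R]_d | forall i, A i -> c i <= pairing x (f i)] =
    \bigcap_(i in A) ((fun x => pairing x (f i)) @^-1` [set t | c i <= t]).
  by apply/seteqP; split.
apply: closed_bigI => i _; apply: closed_comp; last exact: closed_ge.
by move=> x _; exact: continuous_pairing.
Qed.

Lemma bounded_closed_minimized Q :
  Q !=set0 -> bounded_set Q -> closed Q -> minimized Q.
Proof.
move=> Q0 Qb Qc y.
have [] := @EVT_min_rV R d (fun x => pairing x y) Q Q0.
- exact: bounded_closed_compact.
- by apply: continuous_subspaceT; exact: continuous_pairing.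
- by move=> x /set_mem Qx xmin; exists x => // z /mem_set; exact: xmin.
Qed.

Lemma minimized_sum P Q : minimized P -> minimized Q ->
  minimized (minkowski_sum P Q).
Proof.
move=> Pm Qm y; have [x Px xmin] := Pm y; have [z Qz zmin] := Qm y.
exists (x + z); first by exists x => //; exists z.
by move=> _ [x' Px' [z' Qz' <-]]; rewrite !pairingDl lerD ?xmin ?zmin.
Qed.

Lemma Min_sum P Q y : minimized P -> minimized Q ->
  Min (minkowski_sum P Q) y = Min P y + Min Q y.
Proof.
move=> Pm Qm; have [x Px xmin] := Pm y; have [z Qz zmin] := Qm y.
rewrite (Min_eq Px) // (Min_eq Qz) // -pairingDl; apply: Min_eq.
  by exists x => //; exists z.
by move=> _ [x' Px' [z' Qz' <-]]; rewrite !pairingDl lerD ?xmin ?zmin.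
Qed.

End MinLemmas.

Lemma lattice_polytope_bounded {R : realType} {d} (P : set 'rV[R]_d) :
  lattice_polytope P -> bounded_set P.
Proof.
move=> [s ->]; apply: (@norm_bounded _ _ _ (\sum_(v <- s) `|re v : 'rV[R]_d|)).
move=> _ [a [a0 a1 ->]]; apply: (le_trans (ler_norm_sum _ _ _)).
rewrite big_seq [leRHS]big_seq; apply: ler_sum => v vs.
rewrite normrZ ger0_norm // ler_piMl // -a1 (big_rem v) //=.
by rewrite lerDl sumr_ge0.
Qed.

(** * The fine interior and the canonical hull *)

(** Pigeonhole: the multiples of [y] by 0, ..., [N.+1 ^ d] have fractional parts in [N.+1 ^ d] cells
    of side [N.+1%:R^-1], so two of them share a cell; [q] is the difference of their indices. *)
Lemma Dirichlet_approximation {R : realType} {d} (y : 'cV[R]_d) (N : nat) :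
  exists (q : nat) (nu : 'cV[int]_d),
    [/\ (0 < q <= N.+1 ^ d)%N & `|q%:R *: y - re nu| <= N.+1%:R^-1].
Proof.
pose fl (q : nat) i := Num.floor (q%:R * y i 0).
pose cell (q : nat) i : nat := Num.truncn (N.+1%:R * (q%:R * y i 0 - (fl q i)%:~R)).
have frac0 q i : 0 <= q%:R * y i 0 - (fl q i)%:~R by rewrite subr_ge0 floor_le.
have cellN q i : (cell q i < N.+1)%N.
  rewrite /cell truncn_lt_nat ?mulr_ge0 // -[ltRHS]mulr1 ltr_pM2l //.
  by rewrite ltrBlDl -intrD1 floorD1_gt.
pose g (q : 'I_(N.+1 ^ d).+1) : {ffun 'I_d -> 'I_N.+1} :=
  [ffun i => Ordinal (cellN q i)].
have /injectivePn[q1 [q2 q12 /ffunP gq]] : ~~ injectiveb g.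
  apply/injectiveP => /leq_card; rewrite card_ffun !card_ord.
  by rewrite ltnn.
wlog lt12 : q1 q2 q12 gq / (q1 < q2)%N.
  move=> main; have [| |/val_inj eq12] := ltngtP q1 q2; first exact: main.
    by apply: main => [|i]; [rewrite eq_sym | rewrite gq].
  by rewrite eq12 eqxx in q12.
exists (q2 - q1)%N, (\col_i (fl q2 i - fl q1 i)); split.
  by rewrite subn_gt0 lt12 (leq_trans (leq_subr _ _)) // -ltnS.
apply: norm_le_coord => // i j; rewrite !mxE ord1 rmorphB /= natrB 1?ltnW //.
have := gq i; rewrite !ffunE => /(congr1 val) /= c12.
pose u (q : nat) := q%:R * y i 0 - (fl q i)%:~R.
have tr q : (cell q i)%:R <= N.+1%:R * u q < (cell q i).+1%:R.
  by apply: truncn_itv; rewrite mulr_ge0.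
have /andP[l1 h1] := tr q1; have /andP[] := tr q2; rewrite -c12 => l2 h2.
rewrite (_ : _ - _ = u q2 - u q1); last by rewrite /u; ring.
rewrite -(ler_pM2l (_ : 0 < N.+1%:R)) // mulfV ?pnatr_eq0 //.
rewrite -[X in X * `| _ |]ger0_norm // -normrM mulrBr ler_norml.
move: h1 h2; rewrite -natr1 => h1 h2.
by apply/andP; split; lra.
Qed.

(** Indexing the lattice points of a box by a finite type makes a condition on all of them a finite
    conjunction, which a filter can absorb. *)
Definition box_point {d B : nat} (f : {ffun 'I_d -> 'I_(B.*2).+1}) : 'cV[int]_d :=
  \col_i ((f i : nat)%:Z - B%:Z).

Lemma box_pointP {R : realType} {d B : nat} (nu : 'cV[int]_d) :
  `|re nu : 'cV[R]_d| <= B%:R ->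
  exists f : {ffun 'I_d -> 'I_(B.*2).+1}, nu = box_point f.
Proof.
move=> nuB.
have nui i : (`|(nu i 0 + B%:Z)%R|%N < (B.*2).+1)%N /\ 0 <= nu i 0 + B%:Z.
  have := le_trans (coord_le_norm (re nu) i 0) nuB.
  rewrite mxE -intr_norm -[B%:R]/(B%:Z%:~R) ler_int; lia.
exists [ffun i => Ordinal (nui i).1]; apply/colP => i; rewrite mxE ffunE /=.
by have [_] := nui i; lia.
Qed.

Lemma finite_norm_bounded_lattice {R : realType} {d} (M : R) :
  finite_set [set nu : 'cV[int]_d | `|re nu : 'cV[R]_d| <= M].
Proof.
pose B := (Num.truncn `|M|).+1.
apply: (@sub_finite_set _ _ (range (@box_point d B))); last first.
  exact: finite_image.
move=> nu /= nuM; have [|f ->] := @box_pointP R d B nu; last by exists f.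
have /truncn_itv/andP[_ /ltW] := normr_ge0 M.
by apply: le_trans; apply: le_trans nuM _; rewrite ler_norm.
Qed.

Section FineInterior.
Context {R : realType} {d : nat}.
Variable P : set 'rV[R]_d.
Hypotheses (Pb : bounded_set P) (P0 : P !=set0).

Lemma delta_mx_neq0 (i : 'I_d) : delta_mx i 0 != 0 :> 'cV[int]_d.
Proof.
by apply/eqP => /colP /(_ i); rewrite !mxE !eqxx.
Qed.

(** Testing with plus and minus the standard basis vectors already bounds every coordinate. *)
Lemma fine_interior_bounded : bounded_set (fine_interior P).
Proof.
pose c i := Num.max (- (Min P (delta_mx i 0) + 1)) (- (Min P (- delta_mx i 0) + 1)).
apply: (@norm_bounded _ _ _ (\big[Num.max/0]_i c i)) => x Fx.
apply: norm_le_coord => [|i j]; first by apply/bigmax_geP; left.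
apply/bigmax_geP; right; exists j => //; rewrite ord1 /c.
have := Fx _ (delta_mx_neq0 j); rewrite re_delta pairing_delta.
have := Fx (- delta_mx j 0); rewrite oppr_eq0 delta_mx_neq0 reN re_delta.
rewrite pairingNr pairing_delta le_max => /(_ isT) lo hi.
by case: (ger0P (x 0 j)) => x0; apply/orP; [right | left]; lra.
Qed.

(* The lattice vectors only see that the slack is at least 1; Dirichlet
   approximation spreads this to all real directions. *)
Lemma fine_interior_slack : exists2 r : R, 0 < r &
  forall x y, fine_interior P x -> r * `|y| <= pairing x y - Min P y.
Proof.
have [K K0 FK] := bounded_normP fine_interior_bounded.
have [L L0 PL] := bounded_normP Pb.
(* With this [N] the approximation errors at a point of the fine interior and over [P] total at most
   1/2, so half of the lattice slack 1 survives. *)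
pose N := (Num.truncn (2 * (d%:R * (K + L)))).+1.
have NKL : d%:R * (K + L) * N.+1%:R^-1 <= 2^-1.
  rewrite ler_pdivrMr ?ltr0Sn // -ler_pdivrMl // invrK.
  have /truncn_itv/andP[_ /ltW] : 0 <= 2 * (d%:R * (K + L)).
    by rewrite !mulr_ge0 // addr_ge0 // ltW.
  by move/le_trans; apply; rewrite ler_nat /N.
exists (2 * (N.+1 ^ d)%:R)^-1; first by rewrite invr_gt0 mulr_gt0 // ltr0n expn_gt0.
move=> x y Fx; have [->|y0] := eqVneq y 0.
  rewrite normr0 mulr0 pairing0r sub0r oppr_ge0.
  have [p Pp] := P0; apply: le_trans (Min_le 0 Pb Pp) _.
  by rewrite pairing0r.
have ny0 : 0 < `|y| by rewrite normr_gt0.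
have [q [nu [/andP[q0 qN] qnu]]] := Dirichlet_approximation (`|y|^-1 *: y) N.
set t := q%:R / `|y|.
have t0 : 0 < t by rewrite divr_gt0 // ltr0n.
set e := q%:R *: _ - _ in qnu; have nuE : re nu = t *: y - e.
  by rewrite /e scalerA opprB addrC subrK.
(* If [nu] were 0, then [q] would be at most [N.+1%:R^-1], which is below 1 because [N] is a
   successor. *)
have nu0 : nu != 0.
  apply/eqP => nu0; move: qnu; rewrite /e nu0 re0 subr0 scalerA normrZ.
  rewrite gtr0_norm // -/t divfK ?gt_eqF // => qN1.
  suff : (1 : R) <= N.+1%:R^-1 by rewrite invf_ge1 ?ltr0Sn // lern1 /N.
  by apply: le_trans qN1; rewrite ler1n.
have eb z (M : R) : `|z| <= M -> `|pairing z e| <= d%:R * M * N.+1%:R^-1.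
  move=> zM; apply: le_trans (norm_pairing _ _) _.
  by rewrite ler_pM ?mulr_ge0 // ler_wpM2l.
have P_nu : t * Min P y - d%:R * L * N.+1%:R^-1 <= Min P (re nu).
  apply: le_Min => // p Pp; rewrite nuE pairingBr pairingZr.
  have := eb _ _ (PL _ Pp); rewrite ler_norml => /andP[_ pe].
  by rewrite lerB // ler_wpM2l ?(ltW t0) // Min_le.
have := Fx _ nu0; rewrite nuE pairingBr pairingZr -nuE.
have := eb _ _ (FK _ Fx); rewrite ler_norml => /andP[xe _].
move: NKL xe P_nu; rewrite mulrDr mulrDl.
move: (d%:R * K * _) (d%:R * L * _) => a b ab xe P_nu x_nu.
have slack : 2^-1 <= t * (pairing x y - Min P y) by rewrite mulrBr; lra.
have slack0 : 0 <= pairing x y - Min P y.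
  by rewrite -(pmulr_rge0 _ t0); apply: le_trans slack.
(* Since [t * |y|] is [q], a slack of at least [1 / (2t)] is at least [|y| / (2q)]; the bound on [q]
   makes the constant uniform. *)
have tN : t * `|y| <= (N.+1 ^ d)%:R by rewrite divfK ?gt_eqF // ler_nat.
have Nd0 : 0 < (N.+1 ^ d)%:R :> R by rewrite ltr0n expn_gt0.
rewrite invfM mulrAC ler_pdivrMr //.
apply: le_trans (_ : t * (pairing x y - Min P y) * `|y| <= _).
  by rewrite ler_wpM2r.
by rewrite mulrAC mulrC ler_wpM2l.
Qed.

Hypothesis F0 : fine_interior P !=set0.

Lemma fine_interior_minimized : minimized (fine_interior P).
Proof.
apply: bounded_closed_minimized => //; first exact: fine_interior_bounded.
exact: (closed_halfspaces (A := [set nu | nu != 0])).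
Qed.

Lemma fine_interior_Min nu : nu != 0 ->
  Min P (re nu) + 1 <= Min (fine_interior P) (re nu).
Proof. by move=> nu0; apply: le_Min => // x; exact. Qed.

Lemma canonical_hull_sup : P `<=` canonical_hull P.
Proof. by move=> x Px nu _; exact: Min_le. Qed.

Lemma Min_canonical_hull_le y :
  minimized (canonical_hull P) -> Min (canonical_hull P) y <= Min P y.
Proof.
by move=> Cm; apply: le_Min => // x /canonical_hull_sup; exact: minimized_le.
Qed.

Lemma Min_canonical_hull nu : minimized (canonical_hull P) ->
  support_fine_interior P nu -> Min (canonical_hull P) (re nu) = Min P (re nu).
Proof.
move=> Cm Snu; apply/eqP; rewrite eq_le Min_canonical_hull_le //=.
by apply: le_Min => [|x]; [have [p /canonical_hull_sup] := P0; exists p | exact].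
Qed.

(* For lattice vectors nu outside a box the slack absorbs a small step along u;
   the finitely many others with <u, nu> < 0 are not in the support, so have
   slack > 1 at every point of the fine interior. *)
Lemma support_fine_interior_spanning (u : 'rV[R]_d) :
  (forall nu, support_fine_interior P nu -> 0 <= pairing u (re nu)) -> u = 0.
Proof.
(* The point [x] maximizes the pairing with the transpose of [u], so a positive step along [u] that
   stays in the fine interior forces the sum of squares of [u] to be at most 0. *)
move=> uS; have [x Fx xmax] := fine_interior_minimized (- u^T).
have [r r0 slack] := fine_interior_slack.
(* Outside the box [r * |nu|] is at least 2. The step along [u] will cost at most half of
   [r * |nu|], which leaves a slack of at least 1. *)
pose B := (Num.truncn (2 / r)).+1.
have rB : 2 <= r * B%:R.
  have /truncn_itv/andP[_ /ltW] : 0 <= 2 / r by rewrite divr_ge0 // ltW.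
  by rewrite ler_pdivrMr // mulrC.
(* The summand 1 keeps the denominator positive even when [u] is 0. *)
have Dpos : 0 < d%:R * `|u| + 1 :> R by rewrite ltr_wpDl // mulr_ge0.
have [e e0 [eU eB]] : exists2 e : R, 0 < e &
    e * (d%:R * `|u| + 1) <= r / 2 /\
    forall f : {ffun 'I_d -> 'I_(B.*2).+1}, box_point f != 0 ->
      Min P (re (box_point f)) + 1 <= pairing (x + e *: u) (re (box_point f)).
  have near_box : \forall e \near (0 : R)^'+,
    forall f : {ffun 'I_d -> 'I_(B.*2).+1}, box_point f != 0 ->
      Min P (re (box_point f)) + 1 <= pairing (x + e *: u) (re (box_point f)).
    apply: filter_forall => f; set nu := box_point f.
    have [nu0|nu0] := eqVneq nu 0; first exact: nearW.
    have [u_nu|u_nu] := leP 0 (pairing u (re nu)).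
      apply: filterS (nbhs_right_gt 0) => e e0 _.
      rewrite pairingDl pairingZl; apply: ler_wpDr; last exact: Fx.
      by rewrite mulr_ge0 // ltW.
    have : 0 < pairing x (re nu) - Min P (re nu) - 1.
      have := Fx _ nu0; rewrite le_eqVlt => /predU1P[tight|]; last by lra.
      suff /uS : support_fine_interior P nu by rewrite leNgt u_nu.
      split=> //; rewrite tight; apply: Min_eq => // z Fz.
      by rewrite -tight; exact: Fz.
    move: u_nu; rewrite -oppr_gt0 => u_nu gap.
    apply: filterS (nbhs_right_lt (divr_gt0 gap u_nu)) => e He _.
    by move: He; rewrite ltr_pdivlMr // pairingDl pairingZl; lra.
  have c0 : 0 < r / 2 / (d%:R * `|u| + 1) by rewrite !divr_gt0.
  have near_0 : \forall e \near (0 : R)^'+, 0 < e by exact: nbhs_right_gt.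
  have near_c := nbhs_right_lt c0.
  have [e [[e0 ec] He]] := filter_ex (filterI (filterI near_0 near_c) near_box).
  by exists e => //; split => //; rewrite -ler_pdivlMr // ltW.
have Fxe : fine_interior P (x + e *: u).
  move=> nu nu0; have [nuB|nuB] := leP `|re nu : 'cV[R]_d| B%:R.
    by have [f nuf] := box_pointP nuB; rewrite nuf in nu0 *; exact: eB.
  have := slack x (re nu) Fx; rewrite pairingDl pairingZl.
  have := norm_pairing u (re nu); rewrite ler_norml => /andP[+ _].
  rewrite -(ler_pM2l e0) mulrN => lo sl.
  have : e * (d%:R * `|u| + 1) * `|re nu : 'cV[R]_d| <= r / 2 * `|re nu : 'cV[R]_d|.
    by rewrite ler_wpM2r.
  have : r * B%:R <= r * `|re nu : 'cV[R]_d| by rewrite ler_pM2l // ltW.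
  have : 0 <= e * `|re nu : 'cV[R]_d| by rewrite mulr_ge0 // ltW.
  by move: lo sl; nra.
have := xmax _ Fxe; rewrite pairingDl lerDl pairingZl pmulr_rge0 //.
rewrite pairingNr oppr_ge0 pairingE => sq_le0.
apply/rowP => i; rewrite mxE; apply/eqP; rewrite -sqrf_eq0 eq_le sqr_ge0 andbT.
apply: le_trans sq_le0; rewrite (bigD1 i) //= mxE expr2 lerDl sumr_ge0 // => j _.
by rewrite mxE -expr2 sqr_ge0.
Qed.

(** At a minimizer on the fine interior the slack of a support vector is exactly 1, so its norm is
    at most [r^-1]. *)
Lemma finite_support_fine_interior : finite_set (support_fine_interior P).
Proof.
have [r r0 slack] := fine_interior_slack.
apply: sub_finite_set (finite_norm_bounded_lattice (r^-1)) => nu [nu0 Snu] /=.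
have [x [Fx xE]] := minimized_face (re nu) fine_interior_minimized.
rewrite -(ler_pM2l r0) mulfV ?gt_eqF //.
by apply: le_trans (slack x (re nu) Fx) _; rewrite xE Snu addrC addKr.
Qed.

(* phi is positive on the unit sphere and homogeneous, so it grows linearly; on
   the canonical hull it is bounded. *)
Lemma canonical_hull_minimized : minimized (canonical_hull P).
Proof.
apply: bounded_closed_minimized; last 1 first.
- exact: (closed_halfspaces (A := support_fine_interior P)).
- by have [p Pp] := P0; exists p; exact: canonical_hull_sup.
have [S SE] := (finite_seqP _).1 finite_support_fine_interior.
have inS nu : (nu \in S) -> support_fine_interior P nu by move=> nuS; rewrite SE.
(* The total amount by which [u] fails to lie in the recession cone of the canonical hull; the
   spanning lemma says that this cone is 0. *)
pose phi (u : 'rV[R]_d) := \sum_(nu <- S) Num.max 0 (- pairing u (re nu)).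
have phi_cont : continuous phi.
  apply: continuous_big => [|nu _ u]; first exact: add_continuous.
  apply: (@continuous_max R (matrix R 1 d) (fun=> 0) (fun u => - pairing u (re nu))).
    exact: cst_continuous.
  by apply: continuousN; exact: continuous_pairing.
have phiZ t u : 0 <= t -> phi (t *: u) = t * phi u.
  move=> t0; rewrite /phi mulr_sumr; apply: eq_bigr => nu _.
  by rewrite pairingZl -mulrN maxr_pMr // mulr0.
have phi_gt0 u : u != 0 -> 0 < phi u.
  move=> u0; have [phi0|] := boolP (phi u <= 0); last by rewrite ltNge.
  case/eqP: u0; apply: support_fine_interior_spanning => nu Snu.
  have nuS : nu \in S by have : [set` S] nu by rewrite -SE.
  rewrite leNgt; apply/negP => u_nu; move: phi0; apply/negP; rewrite -ltNge.
  rewrite /phi (big_rem nu) //= ltr_wpDr ?sumr_ge0 //.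
    by move=> ? _; rewrite le_max lexx.
  by rewrite lt_max oppr_gt0 u_nu orbT.
have [x0 Fx0] := F0.
pose M := \sum_(nu <- S) Num.max 0 (pairing x0 (re nu) - Min P (re nu)).
have phi_le z : canonical_hull P z -> phi (z - x0) <= M.
  move=> Cz; rewrite /phi /M big_seq [leRHS]big_seq; apply: ler_sum => nu /inS Snu.
  have := Cz _ Snu; rewrite pairingBl opprB => z_nu.
  by rewrite ge_max !le_max lexx /= lerD2l lerN2 z_nu orbT.
(* The sphere is empty when [d] is 0; then every vector is 0 and boundedness is immediate. *)
have [sphere0|] := pselect ([set u : 'rV[R]_d | `|u| = 1] !=set0); last first.
  move=> sphere0; apply: (@norm_bounded _ _ _ 0) => z _.
  rewrite normr_le0; apply: contra_notT sphere0 => z0; exists (`|z|^-1 *: z) => /=.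
  by rewrite normrZ gtr0_norm ?invr_gt0 ?normr_gt0 // mulVf ?normr_eq0.
have [] := @EVT_min_rV R d phi _ sphere0.
- apply: bounded_closed_compact.
    by apply: (@norm_bounded _ _ _ 1) => u /= ->.
  apply: (@closed_comp _ _ (fun u : 'rV[R]_d => `|u|) [set 1]).
    by move=> u _; exact: norm_continuous.
  exact: closed_eq.
- exact: continuous_subspaceT.
move=> c /set_mem /= c1 cmin.
have phic : 0 < phi c by apply: phi_gt0; rewrite -normr_gt0 c1.
apply: (@norm_bounded _ _ _ (`|x0| + M / phi c)) => z Cz.
rewrite -[z](subrK x0) addrC; apply: le_trans (ler_normD _ _) _.
rewrite lerD2l; set u := z - x0; have [->|u0] := eqVneq u 0.
  rewrite normr0 divr_ge0 ?(ltW phic) //; apply: sumr_ge0 => nu _.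
  by rewrite le_max lexx.
rewrite ler_pdivlMr // mulrC -ler_pdivlMr ?normr_gt0 //.
apply: le_trans (_ : phi (`|u|^-1 *: u) <= _).
  apply: cmin; apply: mem_set => /=.
  by rewrite normrZ gtr0_norm ?invr_gt0 ?normr_gt0 // mulVf ?normr_eq0.
by rewrite phiZ ?invr_ge0 // mulrC ler_wpM2r ?invr_ge0 // phi_le.
Qed.

(** If [y] is constant on the sum, it is constant on [P], which lies in the hull. The slacks of [y]
    and [- y] at a point of the fine interior then add up to 0, while each is at least [r * |y|]. *)
Lemma tilde_polytope_nondegenerate (y : 'cV[R]_d) (c : R) :
  (forall x, tilde_polytope P x -> pairing x y = c) -> y = 0.
Proof.
move=> yc; have [f Ff] := F0; have [r r0 slack] := fine_interior_slack.
have yP p : P p -> pairing p y = c - pairing f y.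
  move=> Pp; rewrite -(yc (f + p)) ?pairingDl; first by ring.
  by exists f => //; exists p => //; exact: canonical_hull_sup.
have [p Pp] := P0.
have MinP : Min P y = c - pairing f y.
  by rewrite (Min_eq Pp) (yP _ Pp) // => z Pz; rewrite (yP _ Pz).
have MinPN : Min P (- y) = - (c - pairing f y).
  rewrite (Min_eq Pp) pairingNr (yP _ Pp) // => z Pz.
  by rewrite pairingNr (yP _ Pz).
have := slack f y Ff; have := slack f (- y) Ff.
rewrite MinP MinPN pairingNr normrN => lo hi.
by apply/eqP; rewrite -normr_le0 -(pmulr_rle0 _ r0); lra.
Qed.

End FineInterior.

(** * Normal fans and their refinements *)

Lemma exists_minimal_set {T : Type} (A : set (set T)) : finite_set A ->
  A !=set0 -> exists2 B, A B & forall C, A C -> C `<=` B -> B `<=` C.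
Proof.
move=> /finite_seqP[s ->]; elim: s => [[? //]|B s IH _].
have [[C Cs]|s0] := pselect ([set` s] !=set0); last first.
  exists B => [|C] /=; first exact: mem_head.
  by rewrite inE => /predU1P[->//|Cs]; case: s0; exists C.
have [D Ds Dmin] := IH (ex_intro _ C Cs).
have [BD|BD] := pselect (B `<=` D).
  exists B => [|E] /=; first exact: mem_head.
  rewrite inE => /predU1P[->//|Es] EB.
  by apply: (subset_trans BD); apply: Dmin => //; exact: subset_trans EB BD.
exists D => [|E] /=; first by rewrite inE; apply/orP; right.
by rewrite inE => /predU1P[->//|]; exact: Dmin.
Qed.

Lemma primitive_neq0 {d} (nu : 'cV[int]_d) : primitive nu -> nu != 0.
Proof.
by move=> nup; apply/eqP => nu0; have := nup 0%N nu; rewrite mulr0n => /(_ nu0).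
Qed.

(** Descent on the sum of the absolute values of the coordinates. *)
Lemma primitive_multiple {d} (v : 'cV[int]_d) : v != 0 ->
  exists (k : nat) (nu : 'cV[int]_d), [/\ (0 < k)%N, primitive nu & v = nu *+ k].
Proof.
have [n] := ubnP (\sum_i `|v i 0%R|%N); elim: n v => // n IH v vn v0.
have [vp|] := pselect (primitive v); first by exists 1%N, v.
move=> /existsNP[k /existsNP[mu /not_implyP[vE k1]]].
have mu0 : mu != 0 by apply: contra_neq v0 => mu0; rewrite vE mu0 mul0rn.
have k0 : k != 0%N by apply: contra_neq v0 => k0; rewrite vE k0.
have [|l [nu [l0 nup muE]]] := IH mu _ mu0; last first.
  by exists (l * k)%N, nu; rewrite muln_gt0 l0 lt0n k0 vE muE mulrnA.
have [i mui] : exists i, mu i 0 != 0.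
  apply: contra_neqP mu0 => /forallNP mu0; apply/colP => i; rewrite mxE.
  exact/eqP/negbNE/negP/mu0.
have mu_gt0 : (0 < \sum_i `|mu i 0%R|)%N.
  by rewrite (bigD1 i) //= ltn_addr // absz_gt0.
have : (\sum_i `|v i 0%R| = k * \sum_i `|mu i 0%R|)%N.
  rewrite big_distrr /=; apply: eq_bigr => j _.
  by rewrite vE -scaler_nat mxE abszM natz.
by nia.
Qed.

Section Cones.
Context {R : realType} {d : nat}.
Implicit Types (s : seq 'cV[int]_d) (y : 'cV[R]_d).

Lemma cone_gen_scale s y (t : R) : 0 <= t -> cone_gen s y -> cone_gen s (t *: y).
Proof.
move=> t0 [a a0 ->]; exists (fun v => t * a v) => [v|]; first exact: mulr_ge0.
by rewrite scaler_sumr; apply: eq_bigr => v _; rewrite scalerA.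
Qed.

Lemma cone_gen_mem s v : v \in s -> cone_gen s (re v : 'cV[R]_d).
Proof.
move=> vs; have c0 : (count_mem v s)%:R != 0 :> R.
  by rewrite pnatr_eq0 -lt0n -has_count has_pred1.
(* Coefficients depend on the vector, not on its position in [s], so a repeated [v] is counted each
   time; dividing by the multiplicity corrects this. *)
exists (fun w => if w == v then (count_mem v s)%:R^-1 else 0) => [w|].
  by case: ifP => // _; rewrite invr_ge0.
rewrite (bigID (pred1 v)) /= [X in _ + X]big1 => [|w /negPf ->]; last first.
  by rewrite scale0r.
rewrite addr0 (eq_bigr (fun=> (count_mem v s)%:R^-1 *: re v)); last first.
  by move=> w /eqP ->; rewrite eqxx.
by rewrite big_const_seq iter_addr_0 -scaler_nat scalerA mulfV // scale1r.
Qed.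

Lemma cone_gen1P v y : cone_gen [:: v] y <-> exists2 a : R, 0 <= a & y = a *: re v.
Proof.
split=> [[a a0 ->]|[a a0 ->]]; first by exists (a v); rewrite // big_seq1.
by apply: cone_gen_scale => //; apply: cone_gen_mem; rewrite mem_seq1.
Qed.

Lemma cone_gen_neq0 s y : cone_gen s y -> y != 0 -> exists2 v, v \in s & v != 0.
Proof.
move=> [a _ ->] y0; have [/hasP[v vs v0]|/hasPn s0] := boolP (has (fun v => v != 0) s).
  by exists v.
case/eqP: y0; rewrite big_seq big1 // => v /s0; rewrite negbK => /eqP ->.
by rewrite re0 scaler0.
Qed.

End Cones.

Section NormalFan.
Context {R : realType} {d : nat}.
Variable Q : set 'rV[R]_d.
Hypothesis Qm : minimized Q.
Hypothesis Q_nondegenerate : forall (y : 'cV[R]_d) (c : R),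
  (forall x, Q x -> pairing x y = c) -> y = 0.
Implicit Types (x : 'rV[R]_d) (y z : 'cV[R]_d).
Local Notation h := (Min Q).
Local Notation sigma y := (normal_cone Q (polytope_face Q y)).

Lemma Min_homogeneous (t : R) y : 0 <= t -> h (t *: y) = t * h y.
Proof.
move=> t0; have [x Qx xmin] := Qm y; rewrite (Min_eq Qx xmin) -pairingZr.
by apply: Min_eq => // z Qz; rewrite !pairingZr ler_wpM2l ?xmin.
Qed.

Lemma normal_cone_refl y : sigma y y.
Proof. by move=> x []. Qed.

Lemma normal_cone_in_fan y : normal_fan Q (sigma y).
Proof. by exists y. Qed.

Lemma normal_cone_sub y z : sigma y z -> sigma z `<=` sigma y.
Proof. by move=> yz w zw x xy; apply: zw; split; [case: xy | exact: yz]. Qed.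

Lemma normal_cone_scale y z (t : R) : 0 <= t -> sigma y z -> sigma y (t *: z).
Proof. by move=> t0 yz x xy; rewrite pairingZr (yz _ xy) Min_homogeneous. Qed.

(** At a point of the face both [z] and [- z] are minimal, so [z] is constant on [Q] and
    nondegeneracy applies. *)
Lemma normal_cone_strongly_convex y z : sigma y z -> sigma y (- z) -> z = 0.
Proof.
move=> yz yNz; have [x xy] := minimized_face y Qm.
apply: (@Q_nondegenerate _ (h z)) => x' Qx'; apply/eqP.
rewrite eq_le minimized_le // andbT -(yz _ xy) -lerN2 -!pairingNr (yNz _ xy).
exact: minimized_le.
Qed.

Section Refinement.
Variable Sigma' : set (set 'cV[R]_d).
Hypothesis Sigma'_refines : refinement Sigma' (normal_fan Q).

Lemma refinement_cover y : exists2 tau, Sigma' tau & tau y.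
Proof.
have [_ _ cover] := Sigma'_refines.
have : (\bigcup_(s in normal_fan Q) s) y.
  by exists (sigma y); [exact: normal_cone_in_fan | exact: normal_cone_refl].
by rewrite -cover => -[tau]; exists tau.
Qed.

(* For tau the smallest cone through y: a functional that is nonnegative on tau
   and vanishes at y vanishes on tau, and x - x0 is one for x in the face of y
   and x0 in the face defining a cone of the normal fan around tau. *)
Lemma refinement_cone_in_normal_cone y :
  exists tau, [/\ Sigma' tau, tau y & tau `<=` sigma y].
Proof.
have [[fin _ faces _] sub _] := Sigma'_refines.
pose A := Sigma' `&` [set tau | tau y].
have [] := @exists_minimal_set _ A.
- by apply: sub_finite_set fin => ? [].
- by have [tau Stau tauy] := refinement_cover y; exists tau.
move=> tau [Stau tauy] tau_min; exists tau; split=> // z tauz x [Qx xy].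
have [_ [y2 _ <-] tau_sub] := sub _ Stau.
have [x0 x0y2] := minimized_face y2 Qm.
have x0E w : tau w -> pairing x0 w = h w by move=> /tau_sub; exact.
pose tau0 := [set w | tau w /\ pairing (x - x0) w = 0].
have tau_sub0 : tau `<=` tau0.
  apply: tau_min => [|w []] //; split.
    apply: faces Stau _; exists (x - x0) => // w tauw.
    by rewrite pairingBl x0E // subr_ge0 minimized_le.
  by split=> //; rewrite pairingBl x0E // xy subrr.
have [_ /eqP] := tau_sub0 z tauz.
by rewrite pairingBl x0E // subr_eq0 => /eqP.
Qed.

(** A cone of the refinement that contains [nu] and lies in the normal cone of [nu] is squeezed
    between the ray of [nu] and itself. *)
Lemma normal_fan_rays_refinement : rays (normal_fan Q) `<=` rays Sigma'.
Proof.
move=> nu [nup [y0 _ rayE]]; split=> //.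
have [[_ cones _ _] _ _] := Sigma'_refines.
have [tau [Stau tau_nu tau_sub]] := refinement_cone_in_normal_cone (re nu).
suff -> : cone_gen [:: nu] = tau by [].
apply/seteqP; split=> [w /cone_gen1P[a a0 ->]|w /tau_sub].
  by have [[s sE] _] := cones _ Stau; rewrite sE in tau_nu *; exact: cone_gen_scale.
rewrite -rayE; apply: normal_cone_sub; rewrite rayE.
by apply: cone_gen_mem; rewrite mem_seq1.
Qed.

(** Finiteness of the refinement enters here: one minimizer per cone makes [Min Q] a minimum of
    finitely many linear functions. *)
Lemma refinement_vertices : exists (n : nat) (V : 'I_n -> 'rV[R]_d),
  (forall i, Q (V i)) /\ forall y, exists i, pairing (V i) y = h y.
Proof.
have [[/finite_seqP[s sE] _ _ _] sub _] := Sigma'_refines.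
have /choice[f fP] : forall tau : set 'cV[R]_d, exists x,
    Q x /\ (Sigma' tau -> forall z, tau z -> pairing x z = h z).
  move=> tau; have [Stau|nStau] := pselect (Sigma' tau); last first.
    (* An arbitrary point of [Q] as default, because the choice runs over all sets. *)
    by have [x Qx _] := Qm 0; exists x; split.
  have [_ [y _ <-] tau_sub] := sub _ Stau.
  have [x xy] := minimized_face y Qm; exists x; split; first by case: xy.
  by move=> _ z /tau_sub; exact.
exists (size s), (fun i => f (tnth (in_tuple s) i)); split=> [i|y].
  by have [] := fP (tnth (in_tuple s) i).
have [tau Stau tauy] := refinement_cover y.
have : tau \in in_tuple s by move: Stau; rewrite sE.
case/tnthP => i tauE; exists i; rewrite -tauE.
by have [_ /(_ Stau)] := fP tau; exact.
Qed.

End Refinement.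

(** * Normal cones described by active vertices *)

Section Vertices.
Variables (n : nat) (V : 'I_n -> 'rV[R]_d).
Hypotheses (QV : forall i, Q (V i)) (VMin : forall y, exists i, pairing (V i) y = h y).

Definition active y : {set 'I_n} := [set i | pairing (V i) y == h y].

Lemma activeP i y : reflect (pairing (V i) y = h y) (i \in active y).
Proof. by rewrite inE; exact: eqP. Qed.

(* The largest step t along -z that keeps the vertices minimizing y minimizing. *)
Lemma normal_cone_exit y z : active y \subset active z -> z != 0 ->
  exists t, [/\ 0 < t, h (y - t *: z) = h y - t * h z
             & active y \proper active (y - t *: z)].
Proof.
move=> /fintype.subsetP yz z0.
pose alpha i := pairing (V i) y - h y; pose beta i := pairing (V i) z - h z.
have alpha_ge0 i : 0 <= alpha i by rewrite subr_ge0 minimized_le.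
have beta_ge0 i : 0 <= beta i by rewrite subr_ge0 minimized_le.
(* If every vertex minimized [z], then [z] would be constant on [Q]. *)
have [j0 beta_j0] : exists j, 0 < beta j.
  apply: contra_neqP z0 => /forallNP beta_le0.
  have Vz i : pairing (V i) z = h z.
    have := beta_le0 i => /negP; rewrite -leNgt subr_le0 => Viz.
    by apply/eqP; rewrite eq_le Viz minimized_le.
  apply: (@Q_nondegenerate _ (h z)) => x Qx; apply/eqP.
  rewrite eq_le minimized_le // andbT.
  have [i] := VMin (- z); rewrite pairingNr Vz => hN.
  by rewrite -lerN2 hN -pairingNr minimized_le.
case: (arg_minP (P := fun i => 0 < beta i) (fun i => alpha i / beta i) beta_j0).
move=> i beta_i t_min.
(* Ratio test: [t] is the largest step with [t * beta j <= alpha j] for all [j], and the vertex [i]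
   attaining it becomes active. *)
set t := alpha i / beta i in t_min.
have i_y : i \notin active y.
  apply/negP => /yz/activeP; move: beta_i; rewrite /beta => + iz.
  by rewrite iz subrr ltxx.
have t0 : 0 < t.
  rewrite divr_gt0 // lt_neqAle alpha_ge0 andbT eq_sym subr_eq0.
  by apply: contra i_y => /eqP/activeP.
have step j : t * beta j <= alpha j.
  have := beta_ge0 j; rewrite le_eqVlt => /predU1P[<-|beta_j]; first by rewrite mulr0.
  by rewrite -ler_pdivlMr // t_min.
have VE j : pairing (V j) (y - t *: z) = h y - t * h z + (alpha j - t * beta j).
  by rewrite pairingBr pairingZr /alpha /beta; ring.
have [k /activeP ky] : exists k, pairing (V k) y = h y by exact: VMin.
have act0 j : j \in active y -> pairing (V j) (y - t *: z) = h y - t * h z.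
  by move=> jy; rewrite pairingBr pairingZr (activeP _ _ jy) (activeP _ _ (yz _ jy)).
have hE : h (y - t *: z) = h y - t * h z.
  apply/eqP; rewrite eq_le -{1}(act0 _ ky) minimized_le //=.
  have [j <-] := VMin (y - t *: z).
  by rewrite VE lerDl subr_ge0.
exists t; split=> //; rewrite properE; apply/andP; split.
  by apply/fintype.subsetP => j /act0 jE; apply/activeP; rewrite hE.
apply/fintype.subsetPn; exists i => //; apply/activeP.
by rewrite VE hE /t divfK ?gt_eqF // subrr addr0.
Qed.

(** For the converse, [normal_cone_exit] makes [Min Q] additive along the step; evaluating at any
    minimizer [x] of [y] then bounds the pairing of [x] with [z] above by its minimum. *)
Lemma normal_coneP y z : sigma y z <-> active y \subset active z.
Proof.
split=> [yz|yz x [Qx xy]].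
  by apply/fintype.subsetP => i /activeP iy; apply/activeP; apply: yz.
have [->|z0] := eqVneq z 0.
  by rewrite pairing0r -(scale0r (0 : 'cV[R]_d)) Min_homogeneous // mul0r.
have [t [t0 hE _]] := normal_cone_exit yz z0.
have := minimized_le (y - t *: z) Qm Qx; rewrite hE pairingBr xy pairingZr.
rewrite lerD2l lerN2 ler_pM2l // => xz.
by apply/eqP; rewrite eq_le xz minimized_le.
Qed.

End Vertices.

(** * Generation of normal cones by their rays *)

Section Generation.
Variable Sigma' : set (set 'cV[R]_d).
Hypothesis Sigma'_refines : refinement Sigma' (normal_fan Q).

(** Rationality comes from the refinement: a rational cone through [y] inside the normal cone has a
    nonzero integral generator, which must lie on the line of [y]. Strong convexity fixes the
    signs. *)
Lemma normal_cone_line_ray y : y != 0 ->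
  (forall z, sigma y z -> exists c, z = c *: y) ->
  exists nu (c : R), [/\ rays (normal_fan Q) nu, sigma y (re nu) & y = c *: re nu].
Proof.
move=> y0 line; have [[_ cones _ _] _ _] := Sigma'_refines.
have [tau [Stau tauy tau_sub]] := refinement_cone_in_normal_cone Sigma'_refines y.
have [[s tauE] _] := cones _ Stau.
rewrite tauE in tauy tau_sub.
have [v vs v0] := cone_gen_neq0 tauy y0.
have [k [nu [k0 nup vE]]] := primitive_multiple v0.
have nu0 : re nu != 0 :> 'cV[R]_d by rewrite -re0 (inj_eq re_inj) primitive_neq0.
have y_nu : sigma y (re nu).
  have -> : re nu = k%:R^-1 *: re v :> 'cV[R]_d.
    rewrite vE /re -[nu *+ k]scaler_nat; apply/colP => i; rewrite !mxE /=.
    by rewrite intrM natz -pmulrn mulKf // pnatr_eq0 -lt0n.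
  by apply: normal_cone_scale => //; apply: tau_sub; exact: cone_gen_mem.
have [c nuE] := line _ y_nu.
have c0 : 0 < c.
  have [//|c0|c0] := ltgtP 0 c; last by rewrite nuE -c0 scale0r eqxx in nu0.
  case/eqP: y0; apply: (normal_cone_strongly_convex (@normal_cone_refl y)).
  have -> : - y = (- c^-1) *: re nu.
    by rewrite nuE scalerA mulNr mulVf ?lt_eqF // scaleN1r.
  by apply: normal_cone_scale => //; rewrite oppr_ge0 invr_le0 ltW.
exists nu, c^-1; split=> //; last by rewrite nuE scalerA mulVf ?gt_eqF // scale1r.
split=> //; exists y => //; apply/seteqP; split=> [z yz|z /cone_gen1P[a a0 ->]].
  apply/cone_gen1P; have [b zE] := line _ yz; exists (b / c).
    rewrite divr_ge0 ?(ltW c0) // leNgt; apply/negP => b0.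
    case/eqP: y0; apply: (normal_cone_strongly_convex (@normal_cone_refl y)).
    have -> : - y = (- b^-1) *: z.
      by rewrite zE scalerA mulNr mulVf ?lt_eqF // scaleN1r.
    by apply: normal_cone_scale => //; rewrite oppr_ge0 invr_le0 ltW.
  by rewrite zE nuE scalerA divfK // gt_eqF.
exact: normal_cone_scale.
Qed.

(* If sigma y is not a line, moving out of it from y in two ways writes y as a
   combination of two vectors in smaller cones. *)
Lemma pairing_eq0_on_rays (m : 'rV[R]_d) y :
  (forall nu, rays (normal_fan Q) nu -> sigma y (re nu) -> pairing m (re nu) = 0) ->
  pairing m y = 0.
Proof.
have [n [V [QV VMin]]] := refinement_vertices Sigma'_refines.
have coneP := normal_coneP QV VMin; have exit := normal_cone_exit QV VMin.
(* Induction on the number of inactive vertices; each exit from the cone lowers it. *)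
have [N] := ubnP #|~: active V y|; elim: N y => // N IH y yN my.
have IHsub z : active V y \proper active V z -> pairing m z = 0.
  move=> yz; apply: IH => [|nu nu_ray z_nu].
    rewrite -ltnS; apply: leq_trans yN.
    by rewrite ltnS proper_card // properC.
  apply: my => //; apply: normal_cone_sub z_nu.
  by apply/coneP; exact: proper_sub.
have [->|y0] := eqVneq y 0; first exact: pairing0r.
have [/(normal_cone_line_ray y0)[nu [c [nu_ray y_nu ->]]]|] :=
    pselect (forall z, sigma y z -> exists c, z = c *: y).
  by rewrite pairingZr my ?mulr0.
move=> /existsNP[z /not_implyP[/coneP yz z_line]].
have z0 : z != 0.
  by apply/eqP => z0; apply: z_line; exists 0; rewrite scale0r.
have [t [t0 _ ya]] := exit _ _ yz z0; set a := y - t *: z in ya.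
have a0 : a != 0.
  apply/eqP => a0; apply: z_line; exists t^-1.
  move/eqP: a0; rewrite subr_eq0 => /eqP ->.
  by rewrite scalerA mulVf ?gt_eqF // scale1r.
(* A second exit, now along [a]: both [a] and [y - u *: a] have more active vertices than [y], and
   [y] is a combination of them. *)
have [u [_ _ yb]] := exit _ _ (proper_sub ya) a0.
rewrite -[y](subrK (u *: a)) pairingDr pairingZr.
by rewrite (IHsub _ yb) (IHsub _ ya) mulr0 addr0.
Qed.

End Generation.
End NormalFan.

(** * Pullbacks of the canonical divisor *)

(** Membership in a row space does not change under field extension, so an integral system solvable
    over the reals is solvable over the rationals; clearing denominators gives [k]. *)
Lemma integral_solution {R : realType} {d} (S : seq 'cV[int]_d) (b : 'cV[int]_d -> int)
    (x : 'rV[R]_d) : (forall nu, nu \in S -> pairing x (re nu) = (b nu)%:~R) ->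
  exists2 k : nat, (0 < k)%N &
    exists m : 'rV[int]_d, forall nu, nu \in S -> pairing m nu = k%:Z * b nu.
Proof.
move=> xS; pose nu_ := tnth (in_tuple S).
pose B : 'M[int]_(d, size S) := \matrix_(i, j) nu_ j i 0.
pose bS : 'rV[int]_(size S) := \row_j b (nu_ j).
have ratr_intmx p q (M : 'M[int]_(p, q)) :
    map_mx (ratr : rat -> R) (map_mx intr M) = map_mx intr M.
  by apply/matrixP => i j; rewrite !mxE ratr_int.
have : (map_mx intr bS <= (map_mx intr B : 'M[rat]_(_, _)))%MS.
  rewrite -(map_submx (ratr : {rmorphism rat -> R})) !ratr_intmx; apply/submxP; exists x.
  apply/rowP => j; rewrite !mxE -xS ?mem_tnth // pairingE.
  by apply: eq_bigr => i _; rewrite !mxE.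
case/submxP => q qE; pose D := \prod_j denq (q 0 j).
have D0 : 0 < D by apply: prodr_gt0 => j _; exact: denq_gt0.
have mE j : {mj : int | mj%:~R = D%:~R * q 0 j}.
  exists ((\prod_(i | i != j) denq (q 0 i)) * numq (q 0 j)).
  rewrite /D [in RHS](bigD1 j) //= !intrM [_%:~R * _%:~R in RHS]mulrC -mulrA; congr (_ * _).
  by rewrite -{3}[q 0 j]divq_num_den mulrC divfK // intr_eq0 denq_neq0.
exists `|D|%N; first by rewrite absz_gt0 gt_eqF.
exists (\row_j sval (mE j)) => nu /(@tnthP _ _ (in_tuple S))[j nuE].
apply: (@intr_inj rat); rewrite pairingE gtz0_abs // intrM.
have := congr1 (fun M : 'rV[rat]_(size S) => D%:~R * M 0 j) qE.
rewrite !mxE /nu_ -nuE => ->.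
rewrite rmorph_sum mulr_sumr; apply: eq_bigr => i _.
by rewrite !mxE /= intrM (svalP (mE i)) /nu_ -nuE mulrA.
Qed.

(** A pullback needs one multiplier for all cones, so the multipliers of all subsets of [S] are
    multiplied together. *)
Lemma uniform_integral_solutions {R : realType} {d} (S : seq 'cV[int]_d)
    (b : 'cV[int]_d -> int) : exists2 k : nat, (0 < k)%N &
  forall (A : set 'cV[int]_d) (x : 'rV[R]_d), A `<=` [set` S] ->
    (forall nu, A nu -> pairing x (re nu) = (b nu)%:~R) ->
  exists m : 'rV[int]_d, forall nu, A nu -> pairing m nu = k%:Z * b nu.
Proof.
pose S_ (T : {set 'I_(size S)}) := [seq tnth (in_tuple S) i | i <- enum T].
have /choice[k kP] : forall T, exists k : nat, (0 < k)%N /\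
    forall x : 'rV[R]_d, (forall nu, nu \in S_ T -> pairing x (re nu) = (b nu)%:~R) ->
    exists m : 'rV[int]_d, forall nu, nu \in S_ T -> pairing m nu = k%:Z * b nu.
  move=> T; have [[x xT]|nT] := pselect (exists x : 'rV[R]_d,
      forall nu, nu \in S_ T -> pairing x (re nu) = (b nu)%:~R).
    by have [k k0 km] := integral_solution xT; exists k.
  (* An unsolvable subset imposes nothing and gets multiplier 1. *)
  by exists 1%N; split=> // x xT; case: nT; exists x.
exists (\prod_T k T)%N; first by apply: prodn_gt0 => T; have [] := kP T.
move=> A x AS xA; pose T := [set i | `[< A (tnth (in_tuple S) i) >]]%SET.
have AE nu : A nu <-> nu \in S_ T.
  split=> [Anu|/mapP[i + ->]]; last by rewrite mem_enum inE => /asboolP.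
  have /(@tnthP _ _ (in_tuple S))[i nuE] := AS _ Anu; rewrite nuE.
  by apply: map_f; rewrite mem_enum inE; apply/asboolP; rewrite -nuE.
have [_ kT] := kP T; have [|m mP] := kT x; first by move=> nu /AE; exact: xA.
exists ((\prod_(U | U != T) k U)%N%:Z *: m) => nu /AE Tnu.
by rewrite pairingZl mP // [in RHS](bigD1 T) //= PoszM; ring.
Qed.

(** * The support function of the pulled-back canonical divisor *)

Section Pullback.
Context {R : realType} {d : nat}.
Variable P : set 'rV[R]_d.
Hypotheses (Pb : bounded_set P) (P0 : P !=set0) (F0 : fine_interior P !=set0).
Local Notation F := (fine_interior P).
Local Notation C := (canonical_hull P).
Local Notation Q := (tilde_polytope P).
Local Notation sigma y := (normal_cone Q (polytope_face Q y)).
Local Notation Sigma_tilde := (normal_fan Q).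

Let Fm : minimized F := fine_interior_minimized F0.
Let Cm : minimized C := canonical_hull_minimized Pb P0 F0.
Let Qm : minimized Q := minimized_sum Fm Cm.

Lemma MinB_support nu : support_fine_interior P nu ->
  Min C (re nu) - Min F (re nu) = -1.
Proof. by move=> Snu; rewrite (Min_canonical_hull Pb P0 Cm Snu) Snu.2; ring. Qed.

(** Write a point of the face as [f + c]. On the cone it minimizes the sum, which forces [f] and [c]
    to minimize separately, so [c - f] is the vector. *)
Lemma MinB_linear y : exists x : 'rV[R]_d, forall z, sigma y z ->
  pairing x z = Min C z - Min F z.
Proof.
have [_ [[f Ff [c Cc <-]] fcy]] := minimized_face y Qm.
exists (c - f) => z yz; have := yz (f + c).
rewrite pairingBl pairingDl (Min_sum _ Fm Cm) => fcz.
have := minimized_le z Fm Ff; have := minimized_le z Cm Cc.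
have : pairing f z + pairing c z = Min F z + Min C z.
  by apply: fcz; split=> //; exists f => //; exists c.
lra.
Qed.

Variable Sigma_hat : set (set 'cV[R]_d).
Hypothesis hat_refines : refinement Sigma_hat Sigma_tilde.
Hypothesis hat_rays : rays Sigma_hat = support_fine_interior P.

Lemma tilde_rays_support : rays Sigma_tilde `<=` support_fine_interior P.
Proof.
by rewrite -hat_rays; exact: normal_fan_rays_refinement.
Qed.

Let rays0 (x : 'rV[R]_d) y :
  (forall nu, rays Sigma_tilde nu -> sigma y (re nu) -> pairing x (re nu) = 0) ->
  pairing x y = 0.
Proof.
apply: (pairing_eq0_on_rays Qm _ hat_refines).
exact: tilde_polytope_nondegenerate.
Qed.

(** In the chart of the normal cone of [nu], the local equation and [k] times the vector of
    [MinB_linear] agree on the rays of the normal fan, hence at [nu]. *)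
Lemma canonical_pullback_unique (Sigma : set (set 'cV[R]_d)) (E : divisor) nu :
  is_pullback Sigma Sigma_tilde (canonical_divisor Sigma_tilde) E -> rays Sigma nu ->
  E nu = Min C (re nu) - Min F (re nu).
Proof.
move=> [_ _ [k [m [k0 loc pull]]]] Snu; set y : 'cV[R]_d := re nu.
have k_neq0 : k%:R != 0 :> R by rewrite pnatr_eq0 -lt0n.
have [x xE] := MinB_linear y.
have y_nu : sigma y (re nu) by exact: normal_cone_refl.
have Ty : Sigma_tilde (sigma y) by exact: normal_cone_in_fan.
rewrite -(xE _ y_nu); apply: (mulfI k_neq0); rewrite (pull _ _ Ty Snu y_nu).
rewrite -pairing_re -/y -pairingZl; apply/eqP; rewrite -subr_eq0 -pairingBl; apply/eqP.
apply: rays0 => mu mu_ray y_mu.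
rewrite pairingBl pairingZl xE // MinB_support; last exact: tilde_rays_support.
rewrite pairing_re -(loc _ _ Ty mu_ray y_mu).
by rewrite /canonical_divisor /divisor_sum mem_set // subrr.
Qed.

Lemma canonical_pullback (Sigma : set (set 'cV[R]_d)) :
  is_pullback Sigma Sigma_tilde (canonical_divisor Sigma_tilde)
    (divisor_sum (rays Sigma) (fun nu => Min C (re nu) - Min F (re nu))).
Proof.
split; [by move=> nu nray; rewrite /canonical_divisor /divisor_sum memNset..|].
have [S SE] := (finite_seqP _).1 (finite_support_fine_interior Pb P0 F0).
have [k k0 kP] := @uniform_integral_solutions R d S (fun=> -1).
(* The vector of [MinB_linear] is real. An integral solution is found on the rays of the cone, where
   the values are -1, and the rays then determine it on the whole cone. *)
have /choice[m mP] : forall tau, exists m : 'rV[int]_d, Sigma_tilde tau ->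
    forall z, tau z -> pairing (re m) z = k%:R * (Min C z - Min F z).
  move=> tau; have [[y _ <-]|ntau] := pselect (Sigma_tilde tau); last by exists 0.
  have [x xE] := MinB_linear y.
  have [|nu [/tilde_rays_support nuS y_nu]|m mE] :=
      kP [set nu | rays Sigma_tilde nu /\ sigma y (re nu)] x.
  - by move=> nu [/tilde_rays_support]; rewrite SE.
  - by rewrite xE // MinB_support // mulrN1z.
  exists m => _ z yz; rewrite -xE // -pairingZl.
  apply/eqP; rewrite -subr_eq0 -pairingBl; apply/eqP; apply: rays0 => nu nu_ray z_nu.
  have y_nu : sigma y (re nu) by exact: normal_cone_sub z_nu.
  rewrite pairingBl pairingZl xE // MinB_support; last exact: tilde_rays_support.
  by rewrite pairing_re mE // mulrN1 mulrN1 intrN pmulrn subrr.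
exists k, m; split=> // tau nu Ttau nu_ray tau_nu.
  rewrite -pairing_re (mP _ Ttau) // MinB_support; last exact: tilde_rays_support.
  by rewrite /canonical_divisor /divisor_sum mem_set.
by rewrite -pairing_re (mP _ Ttau) // /divisor_sum mem_set.
Qed.

Lemma hat_crepant : crepant Sigma_hat Sigma_tilde.
Proof.
rewrite /crepant; suff -> : canonical_divisor Sigma_hat =
    divisor_sum (rays Sigma_hat) (fun nu => Min C (re nu) - Min F (re nu)).
  exact: canonical_pullback.
apply/funext => nu; rewrite /canonical_divisor /divisor_sum.
by case: ifPn => // /set_mem; rewrite hat_rays => /MinB_support ->.
Qed.

Lemma hat_extracts_all_crepant : extracts_all_crepant Sigma_hat Sigma_tilde.
Proof.
move=> nu nup _ [Sigma [E [_ nu_ray pull]]]; rewrite addr0 hat_rays.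
rewrite (canonical_pullback_unique pull) // /canonical_divisor /divisor_sum mem_set //.
move=> disc; have nu0 := primitive_neq0 nup; split=> //.
apply/eqP; rewrite eq_le (fine_interior_Min F0 nu0) andbT.
have := Min_canonical_hull_le Pb P0 (re nu) Cm; lra.
Qed.

Lemma canonical_divisor_discrepancy (Sigma : set (set 'cV[R]_d)) nu :
  canonical_divisor Sigma nu =
    divisor_sum (rays Sigma) (fun nu => Min C (re nu) - Min F (re nu)) nu
    + divisor_sum (rays Sigma `\` rays Sigma_tilde)
        (fun nu => Min F (re nu) - Min C (re nu) - 1) nu.
Proof.
rewrite /canonical_divisor /divisor_sum.
have [nuS|nuS] := pselect (rays Sigma nu); last first.
  by rewrite !memNset ?addr0 // => -[].
rewrite mem_set //; have [nuT|nuT] := pselect (rays Sigma_tilde nu).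
  by rewrite (MinB_support (tilde_rays_support nuT)) memNset ?addr0 // => -[].
by rewrite mem_set //; ring.
Qed.

End Pullback.

Theorem corollary6p6 (R : realType) (d : nat) (P : set 'rV[R]_d)
  (latticeP : lattice_polytope P) (fullP : full_dimensional P)
  (FP0 : fine_interior P !=set0)
  (Sigma_tilde : set (set 'cV[R]_d))
  (Sigma_tildeE : Sigma_tilde = normal_fan (tilde_polytope P))
  (Sigma_hat : set (set 'cV[R]_d))
  (hat_refines : projective_refinement Sigma_hat Sigma_tilde)
  (hat_rays : rays Sigma_hat = support_fine_interior P) :
  [/\ crepant Sigma_hat Sigma_tilde,
      forall Sigma : set (set 'cV[R]_d),
        toric_desingularization Sigma Sigma_tilde ->
        exists2 E : divisor,
          is_pullback Sigma Sigma_tilde (canonical_divisor Sigma_tilde) E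
        & canonical_divisor Sigma =
          E + divisor_sum (rays Sigma `\` rays Sigma_tilde)
                (fun nu => Min (fine_interior P) (re nu)
                           - Min (canonical_hull P) (re nu) - 1)
    & maximal_projective_crepant_desingularization Sigma_hat Sigma_tilde].
Proof.
have Pb := lattice_polytope_bounded latticeP.
have P0 : P !=set0.
  by have [x xP] := fullP; exists x; exact: interior_subset.
subst Sigma_tilde; have [refines _] := hat_refines.
have hatK := hat_crepant Pb P0 FP0 refines hat_rays.
split=> // [Sigma _|].
  exists (divisor_sum (rays Sigma) (fun nu =>
    Min (canonical_hull P) (re nu) - Min (fine_interior P) (re nu))).
    exact: (canonical_pullback Pb P0 FP0 refines hat_rays).
  apply/funext => nu; exact: (canonical_divisor_discrepancy Pb P0 FP0 refines hat_rays).
by split=> //; exact: (hat_extracts_all_crepant Pb P0 FP0 refines hat_rays).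
Qed.
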